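(* Let $G$ be a finite connected multigraph without loops on vertices $v_1,\ldots,v_n$, and let $(\mathbf{r},\mathbf{d})$ be an arithmetical structure on $G$ with $\mathbf{r}=(r_1,\ldots,r_n)$. Then \[ |\mathcal{K}(G;\mathbf{r})| = \sum_{\mathcal{T}} \prod_{i=1}^n r_i^{\deg_{\mathcal{T}}(v_i)-2}, \] where the sum ranges over all spanning trees $\mathcal{T}$ of $G$ (as subsets of the edge set of $G$) and $\deg_{\mathcal{T}}(v_i)$ is the degree of $v_i$ in $\mathcal{T}$.
   Context: The adjacency matrix $A$ of $G$ has entry $(i,j)$ equal to the number of edges between $v_i$ and $v_j$. An arithmetical structure on $G$ is a pair $(\mathbf{r},\mathbf{d})$ with $\mathbf{d}\in\mathbb{Z}_{\ge0}^n$ and $\mathbf{r}\in\mathbb{Z}_{>0}^n$ having entries with greatest common divisor $1$, such that $(\mathrm{diag}(\mathbf{d})-A)\mathbf{r}=\mathbf{0}$. Set $L(G,\mathbf{r})=\mathrm{diag}(\mathbf{d})-A$; it has rank $n-1$, and $\mathcal{K}(G;\mathbf{r})$ denotes the (finite) torsion subgroup of the cokernel $\mathbb{Z}^n/L(G,\mathbf{r})\mathbb{Z}^n$. *)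

(* Defs.v *)
From HB Require Import structures.
From mathcomp Require Import all_boot all_order all_algebra.
Set Implicit Arguments. Unset Strict Implicit. Unset Printing Implicit Defensive.
Import Order.TTheory GRing.Theory Num.Theory.
Local Open Scope ring_scope.

(* A loopless multigraph on vertices 'I_n is given by its adjacency matrix
   A : 'M[nat]_n (A i j = number of edges between v_i and v_j). *)
Definition multigraph n (A : 'M[nat]_n) : Prop :=
  (forall i j, A i j = A j i) /\ (forall i, A i i = 0%N).

Definition connected_mg n (A : 'M[nat]_n) : Prop :=
  forall i j : 'I_n, connect (fun x y => (0 < A x y)%N) i j.

Definition Lmat n (A : 'M[nat]_n) (d : 'I_n -> nat) : 'M[int]_n :=
  \matrix_(i, j) (((i == j)%:R * (d i)%:R) - (A i j)%:R).

Definition arith_structure n (A : 'M[nat]_n) (r d : 'I_n -> nat) : Prop :=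
  (forall i, (0 < r i)%N) /\ (\big[gcdn/0%N]_i r i = 1%N) /\
  Lmat A d *m (\col_i ((r i)%:R : int)) = 0.

Definition in_image n (L : 'M[int]_n) (x : 'cV[int]_n) : Prop :=
  exists y : 'cV[int]_n, x = L *m y.

Definition coker_torsion n (L : 'M[int]_n) (x : 'cV[int]_n) : Prop :=
  exists k : nat, (0 < k)%N /\ in_image L ((k%:R : int) *: x).

(* The torsion subgroup of Z^n / L Z^n is finite of order N: there is a
   complete, irredundant system of N representatives of its elements. *)
Definition torsion_coker_card n (L : 'M[int]_n) (N : nat) : Prop :=
  exists s : seq 'cV[int]_n,
    [/\ size s = N,
        (forall x, x \in s -> coker_torsion L x),
        (forall i j, (i < N)%N -> (j < N)%N -> i <> j ->
            ~ in_image L (nth 0 s i - nth 0 s j)) &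
        (forall x, coker_torsion L x -> exists2 y, y \in s & in_image L (x - y))].

(* Edges of the multigraph: triples (i, j, k) with i < j and k < A i j,
   i.e. the k-th of the A i j parallel edges between v_i and v_j. *)
Definition ebound n (A : 'M[nat]_n) : nat := \max_(p : 'I_n * 'I_n) A p.1 p.2.

Definition Edge n (A : 'M[nat]_n) : finType := ('I_n * 'I_n * 'I_(ebound A))%type.

Definition is_edge n (A : 'M[nat]_n) (e : Edge A) : bool :=
  (e.1.1 < e.1.2)%N && (e.2 < A e.1.1 e.1.2)%N.

Definition adjT n (A : 'M[nat]_n) (T : {set Edge A}) : rel 'I_n :=
  fun x y => [exists k : 'I_(ebound A), ((x, y, k) \in T) || ((y, x, k) \in T)].

Definition spans n (A : 'M[nat]_n) (T : {set Edge A}) : bool :=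
  [forall x, forall y, connect (adjT T) x y].

Definition acyclic n (A : 'M[nat]_n) (T : {set Edge A}) : bool :=
  [forall e in T, ~~ connect (adjT (T :\ e)) e.1.1 e.1.2].

Definition spanning_tree n (A : 'M[nat]_n) (T : {set Edge A}) : bool :=
  [&& T \subset [set e | is_edge e], spans T & acyclic T].

Definition degT n (A : 'M[nat]_n) (T : {set Edge A}) (i : 'I_n) : nat :=
  #|[set e in T | (e.1.1 == i) || (e.1.2 == i)]|.

(* Main.v *)
Require Import Defs.
From HB Require Import structures.
From mathcomp Require Import all_boot all_order all_algebra all_fingroup.
Import Order.TTheory GRing.Theory Num.Theory.
Local Open Scope ring_scope.
Set Implicit Arguments.
Unset Strict Implicit.

(* The Smith normal form L = U D V has D = diag(d_1, ..., d_(n-1), 0) with all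
   d_i nonzero, so the torsion of the cokernel has order N = |d_1 ... d_(n-1)|.
   The last column of the inverse of V and the last row of the inverse of U span
   the right and left kernels of L, so both equal r up to sign; comparing
   determinants gives |det(L + E_kk)| = N r_k^2.

   On the other hand, conjugating L by diag(r) gives the Laplacian of G with
   weight r_i r_j on each edge between v_i and v_j.  Expanding its determinant
   reduced at k multilinearly, row by row, yields a sum over all choices of an
   edge at each vertex other than k.  Such a choice contributes its weight if
   following the chosen edges always leads to k, and 0 otherwise; the
   contributing choices are exactly the spanning trees of G oriented towards k. *)

(** * Arborescences and spanning trees *)

Lemma fconnect_step (T : finType) (g : T -> T) (x y : T) :
  x != y -> fconnect g x y = fconnect g (g x) y.
Proof. by move=> xy; rewrite fconnect_eqVf (negPf xy). Qed.

Lemma fconnect_fixed (T : finType) (g : T -> T) (x y : T) :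
  g x = x -> fconnect g x y -> x = y.
Proof. by move=> gx /iter_findex; rewrite iter_fix. Qed.

(** If some orbit misses [k], the indicator of the vertices whose orbit misses [k] is a nonzero
    kernel vector: it is constant along [g] away from [k] and vanishes at [k]. Otherwise only the
    identity permutation contributes, and every diagonal entry is 1 because no vertex other than [k]
    is fixed by [g]. *)
Lemma det_functional (R : idomainType) (n : nat) (g : 'I_n -> 'I_n) (k : 'I_n) :
  \det (\matrix_(i, j) ((i == j)%:R - ((i != k) && (g i == j))%:R) : 'M[R]_n) =
    [forall i, fconnect g i k]%:R.
Proof.
case: forallP => [reach|nreach]; last first.
  apply/eqP; rewrite -det_tr; apply/det0P.
  exists (\row_i (~~ fconnect g i k)%:R).
    apply/eqP => /rowP v0; apply: nreach => i; apply/negPn/negP => nik.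
    by have /eqP := v0 i; rewrite !mxE nik oner_eq0.
  apply/rowP => i; rewrite !mxE.
  under eq_bigr => j _ do rewrite !mxE mulrBr.
  rewrite sumrB (bigD1 i) //= eqxx mulr1 big1 ?addr0; last first.
    by move=> j ji; rewrite eq_sym (negPf ji) mulr0.
  have [->|ik] /= := eqVneq i k.
    by rewrite connect0 sub0r big1 ?oppr0 // => j _; rewrite mulr0.
  rewrite (bigD1 (g i)) //= eqxx mulr1 big1 ?addr0; last first.
    by move=> j ji; rewrite eq_sym (negPf ji) mulr0.
  by rewrite (fconnect_step _ ik) subrr.
(* A nontrivial permutation contributing to the determinant moves i along g,
   hence moves every iterate of g at i, including k, which is impossible. *)
rewrite /determinant (bigD1 (1%g : {perm _})) //= odd_perm1 expr0 mul1r.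
rewrite [X in _ + X]big1 ?addr0.
  rewrite big1 // => i _; rewrite !mxE perm1 eqxx.
  case: (eqVneq i k) => [|ik]; rewrite ?subr0 //=.
  case: eqP => [gi|]; rewrite ?subr0 //.
  by rewrite (fconnect_fixed gi (reach i)) eqxx in ik.
move=> s s1; apply/eqP; rewrite mulf_eq0; apply/orP; right.
apply/negPn/negP => /prodf_neq0 moved; case/eqP: s1; apply/permP => i; rewrite perm1.
apply/eqP/negPn/negP => si.
suff mv m : s (iter m g i) != iter m g i.
  have := mv (findex g i k); rewrite iter_findex // => sk.
  by have := moved k isT; rewrite !mxE [k == s k]eq_sym (negPf sk) eqxx subr0 eqxx.
elim: m => //= m IH; have := moved (iter m g i) isT; rewrite !mxE [_ == s _]eq_sym (negPf IH).
case: (iter m g i == k); rewrite ?subr0 ?eqxx //=.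
have [gE _|_] := eqVneq (g (iter m g i)) _; last by rewrite subr0 eqxx.
by rewrite gE (inj_eq perm_inj).
Qed.

Definition incident (n : nat) (A : 'M[nat]_n) (e : Edge A) (i : 'I_n) : bool :=
  (e.1.1 == i) || (e.1.2 == i).

(** Meaningful when [e] is incident to [i]; otherwise the value defaults to the first endpoint. *)
Definition opposite (n : nat) (A : 'M[nat]_n) (e : Edge A) (i : 'I_n) : 'I_n :=
  if e.1.1 == i then e.1.2 else e.1.1.

(** A vertex without a chosen edge is its own parent, so the root of an arborescence is a fixed
    point and reaching it can be stated with [fconnect]. *)
Definition parent (n : nat) (A : 'M[nat]_n) (f : 'I_n -> option (Edge A))
    (i : 'I_n) : 'I_n :=
  if f i is Some e then opposite e i else i.

(* An arborescence rooted at k is encoded by the map sending every vertex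
   other than k to the first edge on its way to k, and k to None. *)
Definition edge_choice (n : nat) (A : 'M[nat]_n) (k : 'I_n)
    (f : 'I_n -> option (Edge A)) : bool :=
  [forall i, if f i is Some e then [&& i != k, is_edge e & incident e i]
             else i == k].

Definition arborescence (n : nat) (A : 'M[nat]_n) (k : 'I_n)
    (f : 'I_n -> option (Edge A)) : bool :=
  edge_choice k f && [forall i, fconnect (parent f) i k].

Definition edges_of (n : nat) (A : 'M[nat]_n) (f : 'I_n -> option (Edge A)) :
    {set Edge A} :=
  [set e | [exists i, f i == Some e]].

Lemma adjT_sym (n : nat) (A : 'M[nat]_n) (T : {set Edge A}) :
  symmetric (adjT T).
Proof. by move=> x y; apply: eq_existsb => z; rewrite orbC. Qed.

Lemma connect_adjT_sym (n : nat) (A : 'M[nat]_n) (T : {set Edge A}) :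
  connect_sym (adjT T).
Proof. exact: sym_connect_sym (adjT_sym T). Qed.

Lemma adjTP (n : nat) (A : 'M[nat]_n) (T : {set Edge A}) (x y : 'I_n) :
  reflect (exists2 e, e \in T & incident e x /\ opposite e x = y) (adjT T x y).
Proof.
rewrite /incident /opposite; apply: (iffP existsP) => [[z /orP[]zT]|].
- by exists (x, y, z); rewrite //= eqxx.
- exists (y, x, z) => //=; rewrite eqxx orbT; split=> //.
  by case: eqP => [->|].
move=> [[[a b] z] abz /= []]; have [<-|ax] := eqVneq a x => /=.
  by move=> _ <-; exists z; rewrite abz.
by move=> /eqP <- <-; exists z; rewrite abz orbT.
Qed.

Lemma opposite_incident (n : nat) (A : 'M[nat]_n) (e : Edge A) (i j : 'I_n) :
  incident e i -> incident e j -> i != j -> opposite e i = j.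
Proof.
rewrite /incident /opposite; have [<-|_] := eqVneq e.1.1 i => /=.
  by move=> _ /orP[/eqP ->|/eqP]; rewrite ?eqxx.
by move=> /eqP <- /orP[/eqP|/eqP ->]; rewrite ?eqxx.
Qed.

Lemma subset_adjT (n : nat) (A : 'M[nat]_n) (S T : {set Edge A}) :
  S \subset T -> subrel (connect (adjT S)) (connect (adjT T)).
Proof.
move=> /subsetP ST; apply: connect_sub => x y /adjTP[e /ST eT ?].
by apply: connect1; apply/adjTP; exists e.
Qed.

Lemma mem_edges_of (n : nat) (A : 'M[nat]_n) (f : 'I_n -> option (Edge A))
    (i : 'I_n) (e : Edge A) : f i = Some e -> e \in edges_of f.
Proof. by move=> fi; rewrite inE; apply/existsP; exists i; rewrite fi. Qed.

Lemma arborescence_edge (n : nat) (A : 'M[nat]_n) (k i : 'I_n) (e : Edge A)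
    (f : 'I_n -> option (Edge A)) :
  arborescence k f -> f i = Some e ->
  [/\ i != k, is_edge e, incident e i & parent f i = opposite e i].
Proof.
by move=> /andP[/forallP/(_ i) + _] fi; rewrite /parent fi => /and3P[].
Qed.

Lemma arborescence_reach (n : nat) (A : 'M[nat]_n) (k i : 'I_n)
    (f : 'I_n -> option (Edge A)) :
  arborescence k f -> fconnect (parent f) i k.
Proof. by move=> /andP[_ /forallP]. Qed.

Lemma arborescence_root (n : nat) (A : 'M[nat]_n) (k i : 'I_n)
    (f : 'I_n -> option (Edge A)) :
  arborescence k f -> (f i == None) = (i == k).
Proof.
move=> /andP[/forallP/(_ i)].
by case: (f i) => [e /and3P[/negPf ->]|/eqP ->]; rewrite ?eqxx.
Qed.

(** If [i] returned to itself after [m.+1] steps, it would also do so after [q * m.+1] steps, where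
    [q] steps lead from [i] to [k]. Since [k] is fixed and at least [q] steps have been made, this
    point is also [k]. *)
Lemma arborescence_nocycle (n : nat) (A : 'M[nat]_n) (k i : 'I_n)
    (f : 'I_n -> option (Edge A)) :
  arborescence k f -> i != k -> ~~ fconnect (parent f) (parent f i) i.
Proof.
move=> arb ik; apply/negP => /iter_findex; set m := findex _ _ _ => cyc.
have pk : parent f k = k.
  by have := arborescence_root k arb; rewrite eqxx /parent => /eqP ->.
have per q : iter (q * m.+1) (parent f) i = i.
  by elim: q => // q IH; rewrite mulSn iterD IH iterSr.
have := iter_findex (arborescence_reach i arb).
set q := findex _ _ _ => qk.
have : iter (q * m.+1) (parent f) i = k.
  by rewrite mulnS addnC iterD qk iter_fix.
by rewrite per => ikE; rewrite ikE eqxx in ik.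
Qed.

(** Two distinct vertices choosing the same edge would be each other's parents, which is a cycle. *)
Lemma arborescence_inj (n : nat) (A : 'M[nat]_n) (k i j : 'I_n) (e : Edge A)
    (f : 'I_n -> option (Edge A)) :
  arborescence k f -> f i = Some e -> f j = Some e -> i = j.
Proof.
move=> arb fi fj; apply/eqP/negPn/negP => ij.
have [ik _ ei pi] := arborescence_edge arb fi.
have [jk _ ej pj] := arborescence_edge arb fj.
have := arborescence_nocycle arb ik.
rewrite pi (opposite_incident ei ej ij).
have <- : parent f j = i by rewrite pj (opposite_incident ej ei) // eq_sym.
by rewrite fconnect1.
Qed.

(* Without the edge e chosen by i, being a descendant of i is invariant along
   the remaining edges. *)
Lemma arborescence_cut (n : nat) (A : 'M[nat]_n) (k i : 'I_n) (e : Edge A)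
    (f : 'I_n -> option (Edge A)) :
  arborescence k f -> f i = Some e ->
  ~~ connect (adjT (edges_of f :\ e)) i k.
Proof.
move=> arb fi; have [ik _ ei pi] := arborescence_edge arb fi.
have step x y : adjT (edges_of f :\ e) x y ->
    fconnect (parent f) x i = fconnect (parent f) y i.
  move=> /adjTP[e']; rewrite !inE => /andP[e'e /existsP[j /eqP fj]] [ex oy].
  have [_ _ ej pj] := arborescence_edge arb fj.
  have ji : j != i by apply: contraNneq e'e => ji; move: fj; rewrite ji fi => -[->].
  have [xj|xj] := eqVneq x j.
    by rewrite -oy xj -pj fconnect_step.
  have -> : y = j by rewrite -oy (opposite_incident ex ej xj).
  by rewrite (fconnect_step _ ji) pj (opposite_incident ej ex) // eq_sym.
have cl : fingraph.closed (adjT (edges_of f :\ e))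
            [pred x | fconnect (parent f) x i].
  by move=> x y /step xy; rewrite !inE.
apply/negP => /(closed_connect cl); rewrite !inE connect0 => /esym ki.
have pk : parent f k = k.
  by have := arborescence_root k arb; rewrite eqxx /parent => /eqP ->.
by rewrite (fconnect_fixed pk ki) eqxx in ik.
Qed.

(** The path from [x] to [k] avoids [i], so all its edges are chosen by other vertices and differ
    from [e] by injectivity of the choice. *)
Lemma arborescence_keep (n : nat) (A : 'M[nat]_n) (k i x : 'I_n) (e : Edge A)
    (f : 'I_n -> option (Edge A)) :
  arborescence k f -> f i = Some e -> ~~ fconnect (parent f) x i ->
  connect (adjT (edges_of f :\ e)) x k.
Proof.
move=> arb fi; have := iter_findex (arborescence_reach x arb).
move: (findex _ _ _) => m; elim: m x => [x /= -> //|m IH x]; rewrite iterSr => xk nxi.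
have xi : x != i by apply: contraNneq nxi => ->; rewrite connect0.
have pxk : connect (adjT (edges_of f :\ e)) (parent f x) k.
  by apply: IH; rewrite // -fconnect_step.
apply: connect_trans pxk; case fx: (f x) => [e'|]; last first.
  by rewrite /parent fx connect0.
have [_ _ ex px] := arborescence_edge arb fx.
apply: connect1; apply/adjTP; exists e'; last by rewrite px.
rewrite !inE; apply/andP; split; last by apply/existsP; exists x; rewrite fx.
by apply: contraNneq xi => e'e; move: fx; rewrite e'e => /(arborescence_inj arb)/(_ fi) ->.
Qed.

Lemma arborescence_spans (n : nat) (A : 'M[nat]_n) (k : 'I_n)
    (f : 'I_n -> option (Edge A)) :
  arborescence k f -> spans (edges_of f).
Proof.
move=> arb; suff xk x : connect (adjT (edges_of f)) x k.
  apply/forallP => x; apply/forallP => y.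
  by apply: connect_trans (xk x) _; rewrite connect_adjT_sym.
apply: (@connect_sub _ (frel (parent f))) (arborescence_reach x arb).
move=> a b /eqP <-; case fa: (f a) => [e|]; last by rewrite /parent fa connect0.
have [_ _ ea pa] := arborescence_edge arb fa.
by apply: connect1; apply/adjTP; exists e; rewrite ?(mem_edges_of fa).
Qed.

Lemma arborescence_tree (n : nat) (A : 'M[nat]_n) (k : 'I_n)
    (f : 'I_n -> option (Edge A)) :
  arborescence k f -> spanning_tree (edges_of f).
Proof.
move=> arb; apply/and3P; split; last 2 first.
- exact: arborescence_spans arb.
- apply/forall_inP => e; rewrite inE => /existsP[i /eqP fi].
  have [ik _ ei pi] := arborescence_edge arb fi.
  (* If the ends of [e] stayed connected without [e], then [i] would still reach its parent, and
     from there [k], against the cut property. *)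
  have := arborescence_cut arb fi; apply: contraNN => econn.
  suff : connect (adjT (edges_of f :\ e)) i (parent f i).
    move=> /connect_trans; apply; apply: (arborescence_keep arb fi).
    exact: arborescence_nocycle arb ik.
  rewrite pi /opposite; case: eqP ei => [<- //|ne]; rewrite /incident.
  by case: eqP => // _ /= /eqP <-; rewrite connect_adjT_sym.
apply/subsetP => e; rewrite !inE => /existsP[i /eqP fi].
by have [] := arborescence_edge arb fi.
Qed.

(** Suppose [e] is chosen by [i] in [f] and by [j], distinct from [i], in [g]. Then [j] is the
    parent of [i] in [f], so it still reaches [k] after removal of [e]; in [g] that removal
    separates [j] from [k]. *)
Lemma edges_of_inj (n : nat) (A : 'M[nat]_n) (k : 'I_n)
    (f g : 'I_n -> option (Edge A)) :
  arborescence k f -> arborescence k g -> edges_of f = edges_of g -> f =1 g.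
Proof.
move=> af ag fg i; case fi: (f i) => [e|]; last first.
  have := arborescence_root i af; rewrite fi eqxx => /esym ik.
  by have := arborescence_root i ag; rewrite ik => /eqP.
have := mem_edges_of fi; rewrite fg inE => /existsP[j /eqP gj].
have [<- //|ji] := eqVneq j i.
have [jk _ ej _] := arborescence_edge ag gj.
have [ik _ ei pi] := arborescence_edge af fi.
case/negP: (arborescence_cut ag gj); rewrite -fg.
apply: (arborescence_keep af fi).
have <- : parent f i = j by rewrite pi (opposite_incident ei ej) // eq_sym.
exact: arborescence_nocycle af ik.
Qed.

(** Each vertex other than [k] chooses an edge of [T] that strictly decreases the distance to [k];
    induction on the distance shows that [k] is reached. *)
Lemma spans_arborescence (n : nat) (A : 'M[nat]_n) (k : 'I_n)
    (T : {set Edge A}) :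
  T \subset [set e | is_edge e] -> spans T ->
  exists2 f : {ffun 'I_n -> option (Edge A)},
    arborescence k f & edges_of f \subset T.
Proof.
move=> /subsetP Te sT.
(* [reach m x] says that a walk of exactly [m] steps in [T] leads from [x] to [k]; the least such
   [m] is the distance. *)
pose reach := fix reach m x := if m is m'.+1 then
  [exists y, adjT T x y && reach m' y] else x == k.
have reachE x : exists m, reach m x.
  have /connectP[p] : connect (adjT T) x k by move/forallP/(_ x)/forallP: sT.
  elim: p x => [|y p IH] x /=; first by move=> _ <-; exists 0%N => /=.
  move=> /andP[xy /IH/[apply] -[m ym]]; exists m.+1 => /=.
  by apply/existsP; exists y; rewrite xy.
pose dist x := ex_minn (reachE x).
have next x : x != k -> exists e, [&& e \in T, incident e x &
                                     (dist (opposite e x) < dist x)%N].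
  move=> xk; rewrite [dist x]/dist; case: ex_minnP => -[|m] /=.
    by rewrite (negPf xk).
  move=> /existsP[y /andP[/adjTP[e eT [ex oy]] ym]] _; exists e.
  by rewrite eT ex oy /dist; case: ex_minnP => m' _; apply.
pose f := [ffun x => if x == k then None else
  [pick e | [&& e \in T, incident e x & (dist (opposite e x) < dist x)%N]]].
have fP x e : f x = Some e -> [/\ x != k, e \in T, incident e x &
                                 (dist (opposite e x) < dist x)%N].
  rewrite ffunE; case: (eqVneq x k) => // xk; case: pickP => // e' /and3P[? ? ?].
  by move=> [<-].
have fN x : f x = None -> x = k.
  rewrite ffunE; case: (eqVneq x k) => // /next[e eP]; case: pickP => // /(_ e).
  by rewrite eP.
exists f; last first.
  by apply/subsetP => e; rewrite inE => /existsP[i /eqP /fP[]].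
apply/andP; split; apply/forallP => x.
  case fx: (f x) => [e|]; last by rewrite (fN _ fx).
  by have [-> /Te + -> _] := fP _ _ fx; rewrite inE => ->.
have [m] := ubnP (dist x); elim: m x => // m IH x; rewrite ltnS => xm.
case fx: (f x) => [e|]; last by rewrite (fN _ fx) connect0.
have [xk _ _ dx] := fP _ _ fx.
rewrite fconnect_step // IH // /parent fx.
exact: leq_trans dx xm.
Qed.

Lemma tree_arborescence (n : nat) (A : 'M[nat]_n) (k : 'I_n)
    (T : {set Edge A}) :
  spanning_tree T ->
  exists2 f : {ffun 'I_n -> option (Edge A)},
    arborescence k f & edges_of f = T.
Proof.
move=> /and3P[Te sT /forall_inP aT].
have [f arb fT] := spans_arborescence k Te sT; exists f => //.
apply/eqP; rewrite eqEsubset fT; apply/subsetP => e eT.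
(* An edge of [T] outside the arborescence would have its ends joined by the arborescence, hence by
   [T] without that edge, against acyclicity. *)
apply/negPn/negP => ef; case/negP: (aT e eT).
have sub : edges_of f \subset T :\ e by rewrite subsetD1 fT.
apply: subset_adjT sub _ _ _.
by have /forallP/(_ e.1.1)/forallP := arborescence_spans arb.
Qed.

(** This makes the sum over trees positive, so that the determinant of the perturbed matrix is
    nonzero. *)
Lemma spanning_tree_exists (n : nat) (A : 'M[nat]_n) (k : 'I_n) :
  multigraph A -> connected_mg A -> exists T : {set Edge A}, spanning_tree T.
Proof.
move=> [symA _] conn.
have sp : spans [set e : Edge A | is_edge e].
  apply/forallP => x; apply/forallP => y; move: (conn x y).
  apply: connect_sub => {}x {}y /= xy.
  have [->|nxy] := eqVneq x y; first exact: connect0.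
  apply: connect1; apply/existsP.
  have lt : (0 < ebound A)%N.
    exact: leq_trans xy (leq_bigmax (F := fun p => A p.1 p.2) (x, y)).
  exists (Ordinal lt); rewrite !inE /is_edge /= [A y x]symA xy !andbT.
  by rewrite -neq_ltn.
have [f arb _] := spans_arborescence k (subxx _) sp.
by exists (edges_of f); apply: arborescence_tree arb.
Qed.

(** * The weighted matrix-tree theorem *)

(** Replacing row [k] by a unit vector has the same effect on the determinant as deleting row and
    column [k], and keeps the index type ['I_n]. *)
Definition rooted_laplacian (R : comPzRingType) (n : nat) (A : 'M[nat]_n)
    (k : 'I_n) (w : Edge A -> R) : 'M[R]_n :=
  \matrix_(i, j) if i == k then (i == j)%:R else
    \sum_(e | is_edge e && incident e i)
      w e * ((i == j)%:R - (opposite e i == j)%:R).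

(** Each edge is chosen by exactly one vertex, and the root contributes 1. *)
Lemma prod_edges_of (R : comPzRingType) (n : nat) (A : 'M[nat]_n) (k : 'I_n)
    (f : 'I_n -> option (Edge A)) (w : Edge A -> R) :
  arborescence k f ->
  \prod_(e in edges_of f) w e = \prod_i oapp w 1 (f i).
Proof.
move=> arb; rewrite [RHS](bigID (fun i => f i == None)) /=.
rewrite [X in _ = X * _]big1 => [|i /eqP -> //]; rewrite mul1r.
pose D := [set i | f i != None].
rewrite [RHS](eq_bigl (mem D)) => [|i]; last by rewrite !inE.
rewrite -(big_imset (oapp w 1)) /=; last first.
  move=> i j; rewrite !inE; case fi: (f i) => [e|] // _ _ /esym.
  exact: arborescence_inj arb fi.
rewrite -(big_imset (oapp w 1) (h := some)) /=; last by move=> ? ? _ _ [].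
apply: eq_bigl => o; apply/imsetP/imsetP => -[x]; rewrite inE.
  by move=> /existsP[i /eqP fi] ->; exists i; rewrite ?inE fi.
case fx: (f x) => [e|] // _ ->; exists e => //.
exact: mem_edges_of fx.
Qed.

Theorem matrix_tree (R : idomainType) (n : nat) (A : 'M[nat]_n) (k : 'I_n)
    (w : Edge A -> R) :
  \det (rooted_laplacian k w) =
    \sum_(T : {set Edge A} | spanning_tree T) \prod_(e in T) w e.
Proof.
(* Row [i] is a combination of the rows [B i o] with coefficients [c i o]. At [k] only [None] has a
   nonzero coefficient; elsewhere only the edges incident to [i] can have one. *)
pose c i o : R := if o is Some e
  then (if [&& i != k, is_edge e & incident e i] then w e else 0)
  else (i == k)%:R.
pose opp i (o : option (Edge A)) := if o is Some e then opposite e i else i.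
pose B i o j : R := (i == j)%:R - ((i != k) && (opp i o == j))%:R.
have entry i j : rooted_laplacian k w i j = \sum_o c i o * B i o j.
  rewrite mxE (bigD1 None) //= /B /=.
  rewrite (reindex_omap some id) => [|[]//].
  have [->|ik] := eqVneq i k => /=.
    by rewrite mul1r subr0 big1 ?addr0 // => e _; rewrite ?eqxx mul0r.
  rewrite mul0r add0r [LHS]big_mkcond [RHS]big_mkcond; apply: eq_bigr => e _.
  by rewrite ik /=; case: ifP => _; rewrite ?eqxx ?mul0r ?if_same.
(* Multilinear expansion: for a fixed choice [f], the rows [B i (f i)] form the matrix of
   [det_functional] for the map [parent f]. *)
have -> : \det (rooted_laplacian k w) =
    \sum_(f : {ffun 'I_n -> option (Edge A)}) (\prod_i c i (f i)) *
       [forall i, fconnect (parent f) i k]%:R.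
  under [RHS]eq_bigr => f _ do rewrite -(det_functional R (parent f) k).
  rewrite /determinant.
  under [LHS]eq_bigr => s _ do
    (under eq_bigr => i _ do rewrite entry;
     rewrite bigA_distr_bigA /= big_distrr /=).
  rewrite exchange_big; apply: eq_bigr => f _.
  rewrite big_distrr; apply: eq_bigr => s _ /=.
  rewrite big_split /= mulrCA; congr (_ * (_ * _)); apply: eq_bigr => i _.
  by rewrite mxE.
pose arbs := [set f : {ffun 'I_n -> option (Edge A)} | arborescence k f].
rewrite [RHS](eq_bigl
  (mem [set edges_of f | f : {ffun 'I_n -> option (Edge A)} in arbs])); last first.
  move=> T; apply/idP/imsetP => [/(tree_arborescence k)[f arb <-]|[f]].
    by exists f; rewrite ?inE.
  by rewrite inE => /arborescence_tree arb ->.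
rewrite big_imset /=; last first.
  by move=> f g; rewrite !inE => af ag /(edges_of_inj af ag)/ffunP.
rewrite [RHS]big_mkcond; apply: eq_bigr => f _ /=; rewrite inE.
(* A choice that violates [edge_choice] at some vertex has a zero coefficient there. *)
rewrite /arborescence; case: (boolP (edge_choice k f)) => [ef|] /=; last first.
  rewrite negb_forall => /existsP[i]; rewrite (bigD1 i) //= /c.
  by case: (f i) => [e|] /negPf ->; rewrite !mul0r.
case: (boolP [forall i, _]) => [reach|_]; last by rewrite mulr0.
rewrite mulr1 (prod_edges_of w (k := k)) /arborescence ?ef //.
apply: eq_bigr => i _; move/forallP/(_ i): ef; rewrite /c.
by case: (f i) => [e ->|->].
Qed.

(** * Counting incident edges and degrees *)

Lemma card_incident (n : nat) (A : 'M[nat]_n) (i j : 'I_n) :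
  multigraph A ->
  #|[pred e : Edge A | [&& is_edge e, incident e i & opposite e i == j]]|
    = A i j.
Proof.
move=> [symA diagA].
have [->|ij] := eqVneq i j.
  rewrite diagA; apply: eq_card0 => -[[a b] z]; rewrite !inE /is_edge /= /incident /opposite /=.
  have [->|aj] := eqVneq a j; last by rewrite (negPf aj) !andbF.
  by have [->|] := eqVneq b j; rewrite ?ltnn ?andbF.
(* Edges are stored with the smaller endpoint first, so the parallel edges between [i] and [j] are
   listed in the matching orientation. *)
pose h (z : 'I_(ebound A)) : Edge A := if (i < j)%N then (i, j, z) else (j, i, z).
have hinj : injective h by rewrite /h => x y; case: ifP => _ [].
transitivity #|[set h z | z in [set z : 'I_(ebound A) | (z < A i j)%N]]|.
  apply: eq_card => -[[a b] z]; rewrite !inE /is_edge /= /incident /opposite /=.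
  apply/idP/imsetP => [|[z']]; last first.
    rewrite inE /h => zA; case: ltnP => [lij|lji] [-> -> ->]; rewrite ?eqxx ?lij ?zA //.
    have -> : (j < i)%N by rewrite ltn_neqAle lji andbT eq_sym.
    by rewrite [j == i]eq_sym (negPf ij) symA zA !eqxx.
  move=> /andP[/andP[ab zA]]; have [ai|ai] := eqVneq a i => /= [/eqP bj|/andP[/eqP bi /eqP aj]].
    by exists z; rewrite ?inE /h -?ai -?bj // ab.
  exists z; rewrite ?inE /h -?aj -?bi; first by rewrite symA.
  by rewrite ltnNge ltnW.
rewrite card_imset // -sum1_card.
have le : (A i j <= ebound A)%N := leq_bigmax (F := fun p => A p.1 p.2) (i, j).
rewrite (eq_bigl (fun z : 'I__ => (z < A i j)%N)) => [|z]; last by rewrite inE.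
by rewrite (big_ord_narrow le) sum1_card card_ord.
Qed.

Lemma sum_incident (V : nmodType) (n : nat) (A : 'M[nat]_n) (i : 'I_n)
    (F : 'I_n -> V) :
  multigraph A ->
  \sum_(e : Edge A | is_edge e && incident e i) F (opposite e i) =
    \sum_j F j *+ A i j.
Proof.
move=> mA; rewrite (partition_big (fun e => opposite e i) xpredT) //=.
apply: eq_bigr => j _; rewrite -(card_incident i j mA) -sumr_const.
by apply: congr_big => [//|e|e /andP[_ /eqP -> //]]; rewrite inE andbA.
Qed.

Lemma prod_endpoints (R : comPzRingType) (n : nat) (A : 'M[nat]_n)
    (T : {set Edge A}) (x : 'I_n -> R) :
  T \subset [set e | is_edge e] ->
  \prod_(e in T) (x e.1.1 * x e.1.2) = \prod_i x i ^+ degT T i.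
Proof.
move=> /subsetP Te; rewrite /degT.
under [RHS]eq_bigr => i _ do rewrite -prodr_const.
rewrite (exchange_big_dep (mem T)) /=; last by move=> i e _; rewrite inE => /andP[].
apply: eq_bigr => e eT; have := Te e eT; rewrite inE => /andP[lt12 _].
have ne : e.1.1 != e.1.2 by rewrite -(inj_eq val_inj) /= neq_ltn lt12.
rewrite (eq_bigl (mem [set e.1.1; e.1.2])) => [|i]; last first.
  by rewrite !inE eT !(eq_sym i).
by rewrite big_setU1 ?inE //= big_set1.
Qed.

(** * Torsion of the cokernel of a symmetric matrix of corank one *)

Lemma in_image_smith (n : nat) (U V : 'M[int]_n) (d : 'rV[int]_n)
    (x : 'cV[int]_n) :
  U \in unitmx -> V \in unitmx ->
  (in_image (U *m diag_mx d *m V) x <->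
   forall i, (d ord0 i %| (invmx U *m x) i ord0)%Z).
Proof.
move=> uU uV; split=> [[y ->] i|dx].
  rewrite -!mulmxA mulKmx // mul_diag_mx mxE.
  exact: dvdz_mulr.
have {dx} : forall i, exists q, (invmx U *m x) i ord0 = q * d ord0 i.
  by move=> i; apply/dvdzP.
move=> /fin_all_exists[q qP]; exists (invmx V *m \col_i q i).
rewrite -!mulmxA mulKVmx // -[LHS](mulKVmx uU); congr (_ *m _).
by apply/colP => i; rewrite mul_diag_mx qP !mxE mulrC.
Qed.

Lemma coker_torsion_smith (n : nat) (U V : 'M[int]_n) (d : 'rV[int]_n)
    (x : 'cV[int]_n) :
  U \in unitmx -> V \in unitmx ->
  (coker_torsion (U *m diag_mx d *m V) x <->
   forall i, d ord0 i = 0 -> (invmx U *m x) i ord0 = 0).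
Proof.
move=> uU uV; split=> [[k [k0 /(in_image_smith _ _ uU uV) kx]] i di|x0].
  have := kx i; rewrite di -scalemxAr mxE dvd0z mulf_eq0 => /orP[|/eqP //].
  by rewrite pnatr_eq0 -leqn0 leqNgt k0.
(* This multiplier is divisible by every nonzero [d ord0 i]; the coordinates with a zero entry
   vanish by hypothesis. *)
exists (\prod_(i | d ord0 i != 0) absz (d ord0 i))%N; split.
  by rewrite prodn_cond_gt0 // => i di; rewrite absz_gt0.
apply/(in_image_smith _ _ uU uV) => i; rewrite -scalemxAr mxE.
have [/x0 ->|di] := eqVneq (d ord0 i) 0; first by rewrite mulr0 dvdz0.
apply: dvdz_mulr; rewrite (bigD1 i) //= natrM; apply: dvdz_mulr.
by rewrite dvdzE natz.
Qed.

Lemma torsion_coker_card_smith (n : nat) (U V : 'M[int]_n) (d : 'rV[int]_n) :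
  U \in unitmx -> V \in unitmx ->
  torsion_coker_card (U *m diag_mx d *m V)
    (\prod_(i | d ord0 i != 0%R) absz (d ord0 i)).
Proof.
(* In the coordinates [invmx U *m x], the representatives are the vectors whose entry [i] lies
   between 0 and [c i - 1]. The value [c i = 1] for a zero diagonal entry forces that coordinate to
   be 0. *)
move=> uU uV; pose c i := if d ord0 i == 0 then 1%N else absz (d ord0 i).
pose S := fprod (fun i : 'I_n => 'I_(c i)).
pose coords (f : S) : 'cV[int]_n := \col_i (f i : nat)%:Z.
have c0 i : (0 < c i)%N by rewrite /c; case: eqVneq => // di; rewrite absz_gt0.
have coords0 f i : d ord0 i = 0 -> coords f i ord0 = 0.
  move=> di; rewrite mxE; move: (f i); rewrite /c di eqxx => z.
  by rewrite ord1.
have sizeE : (\prod_(i | d ord0 i != 0%R) absz (d ord0 i))%N = #|S|.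
  rewrite card_fprod big_mkcond; apply: eq_bigr => i _.
  by rewrite card_ord /c; case: eqVneq.
have dE i : d ord0 i != 0 -> c i = absz (d ord0 i).
  by rewrite /c => /negPf ->.
have [es [ses ues mes]] : exists es : seq S,
    [/\ size es = #|S|, uniq es & forall f, f \in es].
  by exists (enum {: S}); rewrite -cardE enum_uniq; split=> // f; rewrite mem_enum.
exists [seq U *m coords f | f <- es]; rewrite sizeE; split.
- by rewrite size_map.
- move=> _ /mapP[f _ ->]; apply/(coker_torsion_smith _ _ uU uV) => i.
  by rewrite mulKmx //; apply: coords0.
- move=> i j; rewrite -ses => ltiN ltjN ij.
  pose f0 : S := fprod_of_fun (fun i => Ordinal (c0 i)).
  rewrite !(nth_map f0) // -mulmxBr => /(in_image_smith _ _ uU uV).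
  rewrite mulKmx // => dv; apply: ij; apply/eqP.
  rewrite -(nth_uniq f0 ltiN ltjN ues); apply/eqP.
  set f := nth _ _ i in dv *; set g := nth _ _ j in dv *.
  apply/fprodP => l; apply: val_inj => /=; have := dv l.
  have [dl|dl] := eqVneq (d ord0 l) 0.
    by have := coords0 f l dl; have := coords0 g l dl; rewrite !mxE => -[->] [->].
  (* Both coordinates are remainders modulo the absolute value of [d ord0 l], so congruence forces
     equality. *)
  rewrite !mxE -eqz_mod_dvd -modz_abs -[X in _ == X]modz_abs -dE //.
  rewrite !modz_small ?ltz_nat ?ltn_ord //.
  by move=> /eqP [].
move=> x /(coker_torsion_smith _ _ uU uV) tx.
have modP i : (absz ((invmx U *m x) i ord0 %% (c i)%:Z)%Z < c i)%N.
  by rewrite -ltz_nat gez0_abs ?modz_ge0 ?ltz_pmod // ?ltz_nat -?lt0n.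
pose f : S := fprod_of_fun (fun i => Ordinal (modP i)).
exists (U *m coords f); first exact: map_f.
apply/(in_image_smith _ _ uU uV) => i; rewrite mulmxBr mulKmx //.
have [di|di] := eqVneq (d ord0 i) 0.
  by rewrite mxE [X in _ + X]mxE coords0 // tx // subrr dvdz0.
rewrite mxE [X in _ + X]mxE [coords f i ord0]mxE fprodE /=.
rewrite gez0_abs ?modz_ge0 -?lt0n // dE //.
by rewrite modz_abs {1}(divz_eq ((invmx U *m x) i ord0) (d ord0 i)) addrK dvdz_mull.
Qed.

Lemma det_diag_rank1 (R : comPzRingType) (m : nat) (d : 'rV[R]_m.+1)
    (a : 'cV[R]_m.+1) (b : 'rV[R]_m.+1) :
  d ord0 ord_max = 0 ->
  \det (diag_mx d + a *m b) =
    (\prod_(i | i != ord_max) d ord0 i) * (a ord_max ord0 * b ord0 ord_max).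
Proof.
move=> d0.
pose X : 'M[R]_m.+1 :=
  \matrix_(i, j) if j == ord_max then a i ord0 else (i == j)%:R.
pose Y : 'M[R]_m.+1 :=
  \matrix_(i, j) if i == ord_max then b ord0 j else d ord0 i *+ (i == j).
(* The last row of [diag_mx d] vanishes, so the rank-one perturbation is a
   product of two triangular matrices. *)
have -> : diag_mx d + a *m b = X *m Y.
  apply/matrixP => i j; rewrite !mxE big_ord1 (bigD1 ord_max) //= !mxE eqxx.
  rewrite addrC; congr (_ + _); have [->|im] := eqVneq i ord_max.
    rewrite d0 mul0rn big1 // => l lm.
    by rewrite !mxE (negPf lm) eq_sym (negPf lm) mul0r.
  rewrite (bigD1 i) //= big1 => [|l /andP[lm li]]; last first.
    by rewrite !mxE (negPf lm) eq_sym (negPf li) mul0r.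
  by rewrite !mxE (negPf im) eqxx mul1r addr0.
have nmax (i j : 'I_m.+1) : (i < j)%N -> (i == ord_max) = false.
  move=> ij; apply: negbTE; rewrite -(inj_eq val_inj) /= neq_ltn.
  by rewrite (leq_trans ij) // -ltnS.
rewrite det_mulmx -(det_tr X) !det_trig; last 2 first.
- apply/is_trig_mxP => i j ij; rewrite !mxE (nmax _ _ ij).
  by rewrite -(inj_eq val_inj) /= ltn_eqF.
- apply/is_trig_mxP => i j ij; rewrite !mxE (nmax _ _ ij).
  by rewrite -(inj_eq val_inj) /= gtn_eqF.
rewrite (bigD1 ord_max) //= big1 => [|i im]; last by rewrite !mxE (negPf im) eqxx.
rewrite mulr1 [\prod_i Y i i](bigD1 ord_max) //= !mxE eqxx.
rewrite [LHS]mulrA [LHS]mulrC; congr (_ * _); apply: eq_bigr => i im.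
by rewrite !mxE (negPf im) eqxx.
Qed.

Lemma det_kernel (R : idomainType) (n : nat) (M : 'M[R]_n) (v : 'cV[R]_n) :
  v != 0 -> M *m v = 0 -> \det M = 0.
Proof.
move=> v0 Mv; apply/eqP; rewrite -det_tr; apply/det0P; exists v^T.
  by apply: contraNneq v0 => /(congr1 trmx); rewrite trmxK trmx0 => ->.
by rewrite -trmx_mul Mv trmx0.
Qed.

Lemma absz_det_unitmx (n : nat) (U : 'M[int]_n) :
  U \in unitmx -> absz (\det U) = 1%N.
Proof.
move=> uU; have := congr1 absz (congr1 determinant (mulmxV uU)).
by rewrite det_mulmx det1 abszM => /eqP; rewrite muln_eq1 => /andP[/eqP].
Qed.

(* If D has corank one, the kernel of U D V is spanned by the last column of
   the inverse of V, so a primitive kernel vector equals it up to sign. *)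
Lemma smith_kernel (m : nat) (U V : 'M[int]_m.+1) (d : 'rV[int]_m.+1)
    (r : 'I_m.+1 -> nat) (k : 'I_m.+1) :
  U \in unitmx -> V \in unitmx ->
  (forall i, i != ord_max -> d ord0 i != 0) ->
  \big[gcdn/0%N]_i r i = 1%N ->
  (U *m diag_mx d *m V) *m (\col_i (r i)%:R) = 0 ->
  absz (invmx V k ord_max) = r k.
Proof.
move=> uU uV dn0 gcd1; rewrite -!mulmxA => /(congr1 (mulmx (invmx U))).
rewrite mulKmx // mulmx0; set rc := \col_i _; set y := V *m rc => Dy.
have y0 i : i != ord_max -> y i ord0 = 0.
  move=> im; have /colP/(_ i)/eqP := Dy.
  by rewrite mul_diag_mx !mxE mulf_eq0 (negPf (dn0 i im)) => /eqP.
have rE i : (r i)%:Z = invmx V i ord_max * y ord_max ord0.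
  have : rc i ord0 = (invmx V *m y) i ord0 by rewrite mulKmx.
  rewrite [LHS]mxE natz => ->; rewrite mxE (bigD1 ord_max) //= big1 ?addr0 //.
  by move=> j jm; rewrite y0 // mulr0.
(* The only nonzero coordinate of [y] divides every [r i], hence their gcd. *)
have y1 : absz (y ord_max ord0) = 1%N.
  suff : (absz (y ord_max ord0) %| \big[gcdn/0%N]_i r i)%N.
    by rewrite gcd1 dvdn1 => /eqP.
  apply/dvdn_biggcdP => i _.
  by rewrite -[r i]absz_nat rE abszM dvdn_mull.
by rewrite -[r k]absz_nat rE abszM y1 muln1.
Qed.

(** In Smith coordinates [delta_mx k k] becomes a column times a row, and the determinant picks out
    their last entries. Both are [r k] up to sign: [smith_kernel] applies to [L] and, by symmetry,
    to its transposed factorization. *)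
Lemma torsion_coker_card_sym (m : nat) (L : 'M[int]_m.+1)
    (r : 'I_m.+1 -> nat) (k : 'I_m.+1) :
  L^T = L -> \big[gcdn/0%N]_i r i = 1%N -> L *m (\col_i (r i)%:R) = 0 ->
  \det (L + delta_mx k k) != 0 ->
  exists2 N, torsion_coker_card L N &
    absz (\det (L + delta_mx k k)) = (N * r k ^ 2)%N.
Proof.
move=> symL gcd1 Lr; have [U uU [V uV [s sdvd LE]]] := int_Smith_normal_form L.
pose d : 'rV[int]_m.+1 := \row_i s`_i.
have {}LE : L = U *m diag_mx d *m V.
  by rewrite LE; congr (_ *m _ *m _); apply/matrixP => i j; rewrite !mxE.
have detL : \det L = 0.
  apply: det_kernel Lr; apply/eqP => /colP r0.
  have : (0 %| \big[gcdn/0%N]_i r i)%N; last by rewrite gcd1.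
  apply/dvdn_biggcdP => i _; have /eqP := r0 i.
  by rewrite !mxE pnatr_eq0 => /eqP ->.
(* Some diagonal entry vanishes and divides all later ones, so the last one vanishes too; entries
   past the end of [s] are 0 by default. *)
have d0 : d ord0 ord_max = 0.
  move: detL; rewrite LE !det_mulmx det_diag => /eqP.
  have nz W : W \in unitmx -> \det W != 0 :> int.
    by move=> uW; rewrite -absz_eq0 absz_det_unitmx.
  rewrite !mulf_eq0 (negPf (nz _ _ uU)) (negPf (nz _ _ uV)) orbF => /prodf_eq0[i _].
  rewrite !mxE => si; have [sm|ms] := leqP (size s) m; first by rewrite nth_default.
  have tr : transitive dvdz by move=> ? ? ?; apply: dvdz_trans.
  have dv : (s`_i %| s`_m)%Z.
    have := @sorted_leq_nth _ _ tr dvdzz 0 _ sdvd i m.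
    rewrite !inE; apply=> //; last by rewrite -ltnS ltn_ord.
    exact: leq_trans (ltn_ord i) ms.
  by move: dv; rewrite (eqP si) dvd0z => /eqP.
pose a := invmx U *m delta_mx k (ord0 : 'I_1).
pose b := delta_mx (ord0 : 'I_1) k *m invmx V.
have -> : L + delta_mx k k = U *m (diag_mx d + a *m b) *m V.
  rewrite mulmxDr mulmxDl -LE; congr (_ + _); rewrite /a /b -!mulmxA.
  by rewrite mulKVmx // mulVmx // mulmx1 mul_delta_mx.
rewrite !det_mulmx det_diag_rank1 // => nz.
(* The nonzero determinant of the perturbed matrix forces corank one. *)
have dn0 i : i != ord_max -> d ord0 i != 0.
  move=> im; apply: contraNneq nz => di.
  by rewrite (bigD1 i) //= di !(mul0r, mulr0).
have aE : absz (a ord_max ord0) = r k.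
  have -> : a ord_max ord0 = invmx U^T k ord_max.
    by rewrite /a -colE mxE -trmx_inv mxE.
  apply: (@smith_kernel _ V^T U^T d r k) => //; rewrite ?unitmx_tr //.
  by rewrite -(tr_diag_mx d) -!trmx_mul mulmxA -LE symL.
have bE : absz (b ord0 ord_max) = r k.
  have -> : b ord0 ord_max = invmx V k ord_max by rewrite /b -rowE mxE.
  by apply: (smith_kernel k uU uV dn0) => //; rewrite -LE.
exists (\prod_(i | d ord0 i != 0%R) absz (d ord0 i))%N.
  by rewrite LE; apply: torsion_coker_card_smith.
rewrite !abszM !absz_det_unitmx // aE bE mul1n muln1; congr (_ * _)%N.
rewrite [RHS](eq_bigl (fun i => i != ord_max)) => [|i].
  by rewrite (big_morph absz abszM (id1 := 1%N)).
have [->|/dn0 ->//] := eqVneq i ord_max.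
by rewrite d0 eqxx.
Qed.

(** * Arithmetical structures *)

Lemma Lmat_kernel (n : nat) (A : 'M[nat]_n) (r d : 'I_n -> nat) (i : 'I_n) :
  Lmat A d *m (\col_i ((r i)%:R : int)) = 0 ->
  \sum_l (r l)%:R *+ A i l = (d i)%:R * (r i)%:R :> int.
Proof.
move=> /colP/(_ i); rewrite !mxE.
under eq_bigr => l _ do rewrite !mxE mulrBl.
rewrite sumrB (bigD1 i) //= eqxx mul1r big1 ?addr0 => [|l li]; last first.
  by rewrite eq_sym (negPf li) !mul0r.
move=> /eqP; rewrite subr_eq0 => /eqP ->; apply: eq_bigr => l _.
by rewrite -mulr_natl.
Qed.

(** Off the diagonal both sides are minus the total weight of the parallel edges. On the diagonal,
    the kernel equation turns the total weight at [i] into [d i] times the square of [r i]. *)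
Lemma scaled_Lmat (n : nat) (A : 'M[nat]_n) (r d : 'I_n -> nat)
    (i j : 'I_n) :
  multigraph A -> Lmat A d *m (\col_i ((r i)%:R : int)) = 0 ->
  \sum_(e : Edge A | is_edge e && incident e i)
      (r e.1.1)%:R * (r e.1.2)%:R * ((i == j)%:R - (opposite e i == j)%:R) =
    (r i)%:R * Lmat A d i j * (r j)%:R.
Proof.
move=> mA Lr.
transitivity (\sum_(e : Edge A | is_edge e && incident e i)
  (r i)%:R * (r (opposite e i))%:R * ((i == j)%:R - (opposite e i == j)%:R) : int).
  apply: eq_bigr => e /andP[_]; rewrite /incident /opposite.
  have [<- //|_ /eqP <-] := eqVneq e.1.1 i.
  by congr (_ * _); rewrite mulrC.
rewrite (sum_incident _
  (fun l => (r i)%:R * (r l)%:R * ((i == j)%:R - (l == j)%:R))) //.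
under eq_bigr => l _ do rewrite mulrBr mulrnBl.
rewrite sumrB [X in _ - X](bigD1 j) //= eqxx mulr1.
rewrite [X in _ - (_ + X)]big1 => [|l /negPf ->]; last by rewrite mulr0 mul0rn.
rewrite addr0 mxE mulrBr mulrBl; congr (_ - _); last first.
  by rewrite -[LHS]mulr_natr mulrAC.
have [<-|_] := eqVneq i j; last first.
  by rewrite mul0r mulr0 mul0r big1 // => l _; rewrite mulr0 mul0rn.
under eq_bigr => l _ do rewrite mulr1 -mulrnAr.
by rewrite -mulr_sumr (Lmat_kernel i Lr) mul1r mulrA.
Qed.

(** Linearity in row [k]: one summand is the determinant of [M], the other has row [k] replaced by a
    unit vector. *)
Lemma det_add_delta (R : comPzRingType) (n : nat) (M : 'M[R]_n) (k : 'I_n) :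
  \det M = 0 ->
  \det (M + delta_mx k k) =
    \det (\matrix_(i, j) if i == k then (i == j)%:R else M i j).
Proof.
move=> M0; set C := \matrix_(i, j) _.
rewrite (determinant_multilinear (B := M) (C := C) (i0 := k) (b := 1) (c := 1)).
- by rewrite M0 mulr0 add0r mul1r.
- by apply/rowP => j; rewrite !mxE eqxx !mul1r eq_sym.
- by apply/matrixP => i j; rewrite !mxE eq_sym (negPf (neq_lift _ _)) addr0.
by apply/matrixP => i j; rewrite !mxE eq_sym (negPf (neq_lift _ _)) addr0.
Qed.

Lemma det_Lmat_trees (n : nat) (A : 'M[nat]_n) (r d : 'I_n -> nat) (k : 'I_n) :
  multigraph A -> arith_structure A r d ->
  (r k)%:R ^+ 2 * \sum_(T : {set Edge A} | spanning_tree T)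
                     \prod_i (r i)%:R ^+ degT T i =
    (\prod_i (r i)%:R) ^+ 2 * \det (Lmat A d + delta_mx k k) :> int.
Proof.
move=> mA [r0 [_ Lr]].
have detL : \det (Lmat A d) = 0.
  apply: det_kernel Lr; apply/eqP => /colP/(_ k)/eqP.
  by rewrite !mxE pnatr_eq0 -leqn0 leqNgt r0.
pose w (e : Edge A) : int := (r e.1.1)%:R * (r e.1.2)%:R.
have -> : \sum_(T : {set Edge A} | spanning_tree T)
    \prod_i (r i)%:R ^+ degT T i = \det (rooted_laplacian k w) :> int.
  rewrite matrix_tree; apply: eq_bigr => T /and3P[Te _ _].
  by rewrite -(prod_endpoints (fun i => (r i)%:R)).
rewrite (det_add_delta k detL); set Lk := \matrix_(i, j) _.
(* Row [k] is a unit vector on both sides. It must not be scaled by [X], and the factor [r k] that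
   it gets from the column scaling [Y] is matched by [Z]. *)
pose X : 'rV[int]_n := \row_i if i == k then 1 else (r i)%:R.
pose Y : 'rV[int]_n := \row_i (r i)%:R.
pose Z : 'rV[int]_n := \row_i if i == k then (r k)%:R else 1.
have scale : diag_mx Z *m rooted_laplacian k w = diag_mx X *m Lk *m diag_mx Y.
  rewrite mul_mx_diag !mul_diag_mx; apply/matrixP => i j; rewrite !mxE.
  have [->|ik] := eqVneq i k; last first.
    by rewrite mul1r (scaled_Lmat i j mA Lr) !mxE.
  by rewrite mul1r; case: eqVneq => [->|_]; rewrite ?mulr1 ?mul1r ?mulr0 ?mul0r.
have detZ : \det (diag_mx Z) = (r k)%:R.
  rewrite det_diag (bigD1 k) //= mxE eqxx big1 ?mulr1 // => i /negPf ik.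
  by rewrite mxE ik.
have detY : \det (diag_mx Y) = \prod_i (r i)%:R.
  by rewrite det_diag; apply: eq_bigr => i _; rewrite mxE.
have detX : (r k)%:R * \det (diag_mx X) = \prod_i (r i)%:R.
  rewrite det_diag (bigD1 k) //= mxE eqxx mul1r [RHS](bigD1 k) //=.
  by congr (_ * _); apply: eq_bigr => i /negPf ik; rewrite mxE ik.
(* One factor [r k] is the determinant of [diag_mx Z]; the other completes that of [diag_mx X] to
   the full product. *)
rewrite expr2 -mulrA -{2}detZ -det_mulmx scale !det_mulmx detY.
by rewrite !mulrA detX mulrAC -expr2.
Qed.

Theorem mainTheorem12 (n : nat) (A : 'M[nat]_n) (r d : 'I_n -> nat) :
  multigraph A -> connected_mg A -> arith_structure A r d ->
  exists N : nat, torsion_coker_card (Lmat A d) N /\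
    (N%:R : rat) =
      \sum_(T : {set Edge A} | spanning_tree T)
         \prod_(i < n) ((r i)%:R : rat) ^ ((degT T i)%:Z - 2).
Proof.
move=> mA cA aA; have [r0 [gcd1 Lr]] := aA.
(* For [n = 0] the empty gcd is 0, not 1. *)
case: n => [|m] in A r d mA cA aA r0 gcd1 Lr *; first by rewrite big_ord0 in gcd1.
pose k : 'I_m.+1 := ord0; have trees := det_Lmat_trees k mA aA.
set tr := \sum_(T | _) _ in trees.
have rn0 i : (r i)%:R != 0 :> int by rewrite pnatr_eq0 -lt0n.
have tr0 : 0 < tr.
  have [T treeT] := spanning_tree_exists k mA cA.
  rewrite /tr (bigD1 T) //= ltr_wpDr ?sumr_ge0 => // [T' _|].
    by apply: prodr_ge0 => i _; rewrite exprn_ge0 ?ler0n.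
  by apply: prodr_gt0 => i _; rewrite exprn_gt0 ?ltr0n.
(* Positivity, and not just nonvanishing, is used below to remove the absolute value. *)
have det0 : 0 < \det (Lmat A d + delta_mx k k).
  have : 0 < (\prod_i (r i)%:R) ^+ 2 * \det (Lmat A d + delta_mx k k) :> int.
    by rewrite -trees mulr_gt0 // exprn_gt0 ?ltr0n.
  by rewrite pmulr_rgt0 // exprn_gt0 // prodr_gt0 // => i _; rewrite ltr0n.
have symL : (Lmat A d)^T = Lmat A d.
  apply/matrixP => i j; rewrite !mxE (proj1 mA); congr (_ - _).
  by case: (eqVneq i j) => [->//|ij]; rewrite !mul0r.
have [N cardN detN] :=
  torsion_coker_card_sym symL gcd1 Lr (lt0r_neq0 det0).
exists N; split=> //.
have trN : tr = (\prod_i (r i)%:R) ^+ 2 * N%:R.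
  have rk0 : (r k)%:R ^+ 2 != 0 :> int by rewrite expf_neq0.
  apply: (mulfI rk0); rewrite trees mulrCA; congr (_ * _).
  by rewrite -(gtz0_abs det0) detN -natrX -natrM mulnC natz.
have qn0 : (\prod_i (r i)%:R) ^+ 2 != 0 :> rat.
  by rewrite expf_neq0 //; apply/prodf_neq0 => i _; rewrite pnatr_eq0 -lt0n.
(* Multiplying by the squared product of the [r i] absorbs the exponents -2 and reduces the claim to
   the integer identity [trN]. *)
apply: (mulfI qn0); rewrite mulr_sumr.
have /(congr1 (fun z : int => z%:~R : rat)) := trN.
have prodE : (\prod_i (r i)%:R)%:~R = \prod_i (r i)%:R :> rat.
  by rewrite rmorph_prod; apply: eq_bigr => i _; rewrite rmorph_nat.
rewrite rmorphM rmorphXn rmorph_sum /= prodE rmorph_nat.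
move=> <-; apply: eq_bigr => T _.
rewrite rmorph_prod -prodrXl -big_split; apply: eq_bigr => i _ /=.
rewrite rmorphXn rmorph_nat !exprnP -expfzDr ?pnatr_eq0 -?lt0n //.
by rewrite addrC subrK.
Qed.
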